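(* Let $k\ge 3$, $\ell\ge 4$ and $m\ge k\ell$ be integers, and let $T_1,T_2,T_3$ be three pairwise disjoint $\ell$-element subsets of $[m]$. If $\mathcal{F}\subseteq\binom{[m]}{k}$ is an intersecting family such that every member of $\mathcal{F}$ intersects each of $T_1,T_2,T_3$, then $$|\mathcal{F}|\le \ell^2\binom{m-3}{k-3}.$$
   Context: $[m]=\{1,2,\dots,m\}$, and $\binom{[m]}{k}$ denotes the family of all $k$-element subsets of $[m]$. A family $\mathcal{F}$ of sets is intersecting if $A\cap B\ne\emptyset$ for all $A,B\in\mathcal{F}$. *)

(* Defs.v *)
From mathcomp Require Import all_boot.

Set Implicit Arguments.
Unset Strict Implicit.
Unset Printing Implicit Defensive.

(* A and B are allowed to coincide. *)
Definition intersecting (T : finType) (F : {set {set T}}) : Prop :=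
  {in F &, forall A B : {set T}, A :&: B != set0}.

Definition ksubsets (T : finType) (k : nat) : {set {set T}} :=
  [set A : {set T} | #|A| == k].

(* Main.v *)
Require Import Defs.
From mathcomp Require Import all_boot.
From mathcomp Require Import perm fingroup.
From mathcomp Require Import zify.

(** Count the [k]-sets [A] with the weight [xyz], where [x], [y], [z] are the
sizes of the traces of [A] on [T1], [T2], [T3].  This weight is the number of
triples in [T1 * T2 * T3] whose three entries belong to [A], so its total over
all [k]-sets is [l ^ 3 * 'C(m - 3, k - 3)] ([sum_trace_products]).  It suffices
to prove that [l * #|F|] is at most this total.

Sort the [k]-sets by [(x, y, z)]; let [N x y z] be the number of sets of that
type and [f x y z] the number of them in [F].  When [M] bounds [x], [y], [z] and
[2 * M <= l], Katona's circle method gives [l * f <= M * N] ([katona_blocks]):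
arrange each [Ti] on a circle of length [l], and let [A i] consist of the arcs
of lengths [x], [y], [z] starting at position [i], together with the [i]-th of
[l] disjoint sets in the rest of the ground set, which is large enough for them
because [k * l <= m].  At most [M] of the sets [A i] can pairwise meet, and
averaging over all rearrangements that preserve the blocks turns this into the
bound on [f].  With [M] the largest of [x], [y], [z], this yields
[l * f <= xyz * N].

If an entry exceeds [l / 2], only [f <= N] remains.  This is still enough as
soon as [l <= xyz], so the only types that may exceed their share are
[(x, 1, 1)] with [l / 2 < x < l] and their rotations, the excess being at most
[(l - x) * N x 1 1].  The type [(x - 1, 2, 1)] has weight [2 * (x - 1)], while the
bounds above use only [x - 1] or [l] of it, and this slack covers the excess
([excess_le_slack]).  Taking the rotation of this rule for the other two
positions, the receiving types are pairwise distinct, so adding the local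
inequalities ([balance]) over all types lets excesses and slacks cancel
([total_balance]). *)

Set Implicit Arguments.
Unset Strict Implicit.
Unset Printing Implicit Defensive.

(** * Permutations preserving a partition into blocks *)

(** Listing the colours of all points in a fixed order, the two colourings give
lists that are permutations of each other, and the permutation of positions is
the desired [s]. *)
Lemma exists_perm_recolor (T : finType) (C : eqType) (f h : T -> C) :
    (forall c, #|[set x | f x == c]| = #|[set x | h x == c]|) ->
  exists s : {perm T}, forall x, h (s x) = f x.
Proof.
move=> fh.
have fiber_count (g : T -> C) c : count_mem c (codom g) = #|[set x | g x == c]|.
  rewrite count_map cardE size_filter -enumT.
  by apply: eq_count => x; rewrite !inE.
have: perm_eq (codom_tuple f) (codom_tuple h).
  by apply/allP => c _ /=; rewrite !fiber_count fh.
case/tuple_permP => p fp.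
have inj_s : injective (fun x => enum_val (p (enum_rank x))).
  by move=> x y /enum_val_inj /perm_inj /enum_rank_inj.
exists (perm inj_s) => x; rewrite permE.
have := congr1 (fun t => nth (f x) t (enum_rank x)) fp.
rewrite nth_codom enum_rankK => ->.
by rewrite (nth_map (enum_rank x)) ?size_enum_ord // nth_ord_enum
  (tnth_nth (f x)) nth_codom.
Qed.

Definition block (T I : finType) (c : T -> I) (i : I) : {set T} :=
  [set x | c x == i].

Definition profile (T I : finType) (c : T -> I) (p : I -> nat) : {set {set T}} :=
  [set A : {set T} | [forall i, #|A :&: block c i| == p i]].

Lemma profileP (T I : finType) (c : T -> I) (p : I -> nat) (A : {set T}) :
  reflect (forall i, #|A :&: block c i| = p i) (A \in profile c p).
Proof. by rewrite inE; apply: (iffP forallP) => h i; apply/eqP. Qed.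

Definition block_perms (T I : finType) (c : T -> I) : {set {perm T}} :=
  [set s : {perm T} | [forall x, c (s x) == c x]].

Lemma block_permsP (T I : finType) (c : T -> I) (s : {perm T}) :
  reflect (forall x, c (s x) = c x) (s \in block_perms c).
Proof. by rewrite inE; apply: (iffP forallP) => h i; apply/eqP. Qed.

Lemma imset_profile (T I : finType) (c : T -> I) (p : I -> nat) s (A : {set T}) :
  s \in block_perms c -> A \in profile c p -> s @: A \in profile c p.
Proof.
move=> /block_permsP cs /profileP hA; apply/profileP => i.
rewrite -hA -[RHS](card_imset _ (@perm_inj _ s)); apply: eq_card => y.
apply/idP/imsetP.
  rewrite !inE => /andP[/imsetP[x xA ->]]; rewrite cs => xi.
  by exists x; rewrite // !inE xA.
by case=> x; rewrite !inE => /andP[xA xi] ->; rewrite imset_f //= cs.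
Qed.

(** Colour each point by its block and by its membership in [A], respectively in
[B]: the colour classes have the same sizes because the profiles agree. *)
Lemma block_perms_transitive (T I : finType) (c : T -> I) (p : I -> nat)
    (A B : {set T}) :
    A \in profile c p -> B \in profile c p ->
  exists2 s, s \in block_perms c & s @: A = B.
Proof.
move=> /profileP hA /profileP hB.
have fiber (D : {set T}) i b : [set x | (c x, x \in D) == (i, b)] =
    if b then D :&: block c i else block c i :\: D.
  by apply/setP => x; case: b; rewrite !inE xpair_eqE ?eqb_id ?eqbF_neg andbC.
have [[i b]|s sAB] := @exists_perm_recolor T _ (fun x => (c x, x \in A))
    (fun x => (c x, x \in B)).
  rewrite !fiber; case: b; first by rewrite hA hB.
  by rewrite !cardsD !(setIC (block c i)) hA hB.
exists s; first by apply/block_permsP => x; case: (sAB x).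
apply/setP => y; rewrite -[y](permKV s) mem_imset ?permKV; last exact: perm_inj.
by case: (sAB ((s^-1)%g y)); rewrite permKV.
Qed.

(** Composing with block-preserving permutations that move [A'] to [A] and [B] to
[B'] injects one set of permutations into the other.  By symmetry the
cardinality depends on the profile only, that is, a random block-preserving
permutation moves any [A] to a uniformly distributed set of its profile. *)
Lemma leq_card_block_perms_to (T I : finType) (c : T -> I) (p : I -> nat)
    (A B A' B' : {set T}) :
    A \in profile c p -> B \in profile c p ->
    A' \in profile c p -> B' \in profile c p ->
  #|[set s in block_perms c | s @: A == B]| <=
  #|[set s in block_perms c | s @: A' == B']|.
Proof.
move=> hA hB hA' hB'.
have [g /block_permsP gG gA] := block_perms_transitive hA' hA.
have [h /block_permsP hG gB] := block_perms_transitive hB hB'.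
rewrite -(card_imset _ (f := fun s : {perm T} => (g * (s * h))%g)); last first.
  by move=> s t /mulgI /mulIg.
apply/subset_leq_card/subsetP => _ /imsetP[s + ->].
rewrite inE => /andP[/block_permsP sG /eqP sA]; rewrite inE; apply/andP; split.
  by apply/block_permsP => x; rewrite !permM hG sG gG.
have -> : (g * (s * h))%g @: A' = h @: (s @: (g @: A')).
  by rewrite -!imset_comp; apply: eq_imset => x; rewrite !permM.
by rewrite gA sA gB.
Qed.

(** Count in two ways the pairs [(s, i)] with [s @: A i] in [F]: every [s] has
at most [M] of them, and for every [i] the image [s @: A i] is equidistributed
on the profile. *)
Lemma katona_averaging (T I : finType) (c : T -> I) (p : I -> nat) (l M : nat)
    (A : 'I_l -> {set T}) (F : {set {set T}}) :
    (forall i, A i \in profile c p) -> F \subset profile c p ->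
    (forall s, s \in block_perms c -> #|[set i | s @: A i \in F]| <= M) ->
  l * #|F| <= M * #|profile c p|.
Proof.
move=> hA /subsetP hF hM.
case: l A hA hM => [//|l] A hA hM.
set G := block_perms c in hM.
(* K is the common number of block permutations moving a set to another. *)
pose K := #|[set s in G | s @: A ord0 == A ord0]|.
have KE i B : B \in profile c p -> #|[set s in G | s @: A i == B]| = K.
  by move=> hB; apply/eqP; rewrite eqn_leq !(leq_card_block_perms_to (p := p)).
have K_gt0 : 0 < K.
  have [s sG sA] := block_perms_transitive (hA ord0) (hA ord0).
  by apply/card_gt0P; exists s; rewrite inE sG sA eqxx.
have fibers i (H : {set {set T}}) : H \subset profile c p ->
    #|[set s in G | s @: A i \in H]| = #|H| * K.
  move/subsetP => hH; rewrite -sum1_card.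
  rewrite (partition_big (fun s : {perm T} => s @: A i) (mem H)) /=; last first.
    by move=> s; rewrite inE => /andP[].
  rewrite -sum_nat_const; apply: eq_bigr => B BH.
  rewrite -(KE i B (hH _ BH)) -sum1_card; apply: eq_bigl => s.
  by rewrite !inE; case: eqP => [->|]; rewrite ?BH ?andbT ?andbF.
have GE : #|G| = #|profile c p| * K.
  rewrite -(fibers ord0) //; apply: eq_card => s; rewrite inE.
  by case: (boolP (s \in G)) => // sG; rewrite (imset_profile sG).
rewrite -(leq_pmul2r K_gt0) -!mulnA -GE -(fibers ord0); last exact/subsetP.
have -> : l.+1 * #|[set s in G | s @: A ord0 \in F]| =
    \sum_(i < l.+1) \sum_(s in G | s @: A i \in F) 1.
  rewrite -[in LHS](card_ord l.+1) -sum_nat_const; apply: eq_bigr => i _.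
  rewrite (fibers ord0) -?(fibers i); try exact/subsetP.
  by rewrite -sum1_card; apply: eq_bigl => s; rewrite inE.
rewrite (exchange_big_dep (mem G)) /=; last by move=> i s _ /andP[].
rewrite mulnC -sum_nat_const; apply: leq_sum => s sG.
apply: leq_trans (hM s sG); rewrite -sum1_card; apply: eq_leq.
by apply: eq_bigl => i; rewrite sG inE.
Qed.

(** * Katona's circle method on several blocks *)

(** For [i < j < l], this says that [i] and [j] are at distance less than [M] on
the circle of length [l]: arcs of length [M] starting there meet. *)
Definition close (l M i j : nat) := (j - i < M) || (l - M < j - i).

Definition spread (T : finType) (l M : nat) (B : 'I_l -> {set T}) :=
  forall i j : 'I_l, i < j -> B i :&: B j != set0 -> close l M i j.

(** Measured from its least element [a], every element of [S] lies below [M] or above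
[l - M].  Shifting the second range down by [l - M] sends all of [S] below [M],
and this is injective on [S] since positions [l - M] apart are not close. *)
Lemma card_pairwise_close (l M : nat) (S : {set 'I_l}) :
    0 < M -> 2 * M <= l ->
    {in S &, forall i j : 'I_l, i < j -> close l M i j} ->
  #|S| <= M.
Proof.
move=> M0 Ml hS; have [->|[i0 i0S]] := set_0Vmem S; first by rewrite cards0.
case: M M0 Ml hS => // M _ Ml hS.
case: (arg_minnP (fun i : 'I_l => val i) i0S) => a aS minimal_a.
have amin (j : 'I_l) : j \in S -> a <= j by move=> jS; apply: minimal_a.
pose f (j : 'I_l) : 'I_M.+1 :=
  if j - a < M.+1 then inord (j - a) else inord (j - a - (l - M.+1)).
have cl j : j \in S -> (j - a < M.+1) || (l - M.+1 < j - a).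
  move=> jS; have := amin j jS; rewrite leq_eqVlt => /orP[/eqP->|].
    by rewrite subnn.
  exact: (hS a j aS jS).
suff inj_f : {in S &, injective f}.
  by rewrite -(card_in_imset inj_f) -[leqRHS]card_ord max_card.
have fE j : j \in S ->
    val (f j) = if j - a < M.+1 then j - a else j - a - (l - M.+1).
  by move=> jS; rewrite /f; have := cl j jS; have := ltn_ord j;
     case: ifP => ? ? ?; rewrite /= inordK //; lia.
move=> i j iS jS /(congr1 val); rewrite !fE //.
have := amin i iS; have := amin j jS; have := cl i iS; have := cl j jS.
have := ltn_ord i; have := ltn_ord j => hj hi cj ci aj ai fij.
have := hS i j iS jS; have := hS j i jS iS; rewrite /close => hji hij.
apply/val_inj => /=; case: (ltngtP i j) => // /[dup] hlt; [move/hij|move/hji];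
by move: fij; case: ifP; case: ifP; lia.
Qed.

(** Turns index functions into subsets of [P]: [g i] lists the positions, in an
enumeration of [P], of the elements of the [i]-th set. *)
Lemma exists_shifts (T : finType) (P : {set T}) (l M w : nat)
    (g : 'I_l -> nat -> nat) :
    (forall i u, u < w -> g i u < #|P|) ->
    (forall i u v, u < w -> v < w -> g i u = g i v -> u = v) ->
    (forall (i j : 'I_l) u v, i < j -> u < w -> v < w -> g i u = g j v ->
       close l M i j) ->
  exists B : 'I_l -> {set T},
    (forall i, B i \subset P /\ #|B i| = w) /\ spread M B.
Proof.
move=> g_lt g_inj g_close.
pose e i (u : 'I_w) := enum_val (Ordinal (g_lt i u (ltn_ord u))).
exists (fun i => [set e i u | u : 'I_w]); split=> [i|i j ij].
  split; first by apply/subsetP => _ /imsetP[u _ ->]; apply: enum_valP.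
  rewrite card_imset ?card_ord // => u v /enum_val_inj [].
  by move/g_inj => /(_ (ltn_ord u) (ltn_ord v)) /val_inj.
case/set0Pn => x /setIP[/imsetP[u _ ->] /imsetP[v _ /enum_val_inj []]].
by move/g_close; apply.
Qed.

(** Arcs of length [w] on a circle of length [l] when [P] has [l] elements, and
consecutive disjoint segments when [P] has room for [l] of them. *)
Lemma exists_windows (T : finType) (P : {set T}) (l M w : nat) :
    (#|P| = l /\ w <= M /\ 2 * M <= l) \/ l * w <= #|P| ->
  exists B : 'I_l -> {set T},
    (forall i, B i \subset P /\ #|B i| = w) /\ spread M B.
Proof.
case=> [[Pl [wM Ml]]|lw].
  pose rot (i : 'I_l) u := if i + u < l then i + u else i + u - l.
  apply: (@exists_shifts T P l M w rot) => [i u|i u v|i j u v];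
    rewrite /rot /close.
  - by rewrite Pl => uw; have := ltn_ord i; case: ifP; lia.
  - by move=> uw vw; have := ltn_ord i; case: ifP; case: ifP; lia.
  - by move=> ij uw vw; have := ltn_ord i; have := ltn_ord j;
      case: ifP; case: ifP; lia.
apply: (@exists_shifts T P l M w (fun i u => i * w + u)) => [i u|i u v|i j u v].
- by move=> uw; have := leq_mul (ltn_ord i) (leqnn w); rewrite mulSn; lia.
- by move=> _ _ /addnI.
- by move=> ij uw vw; have := leq_mul ij (leqnn w); rewrite mulSn; lia.
Qed.

(** Glue the windows of all blocks: whenever the [i]-th and the [j]-th union meet,
they meet inside some block, so [i] and [j] are close. *)
Lemma katona_blocks (T I : finType) (c : T -> I) (p : I -> nat) (l M : nat)
    (F : {set {set T}}) :
    0 < M -> 2 * M <= l ->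
    (forall i, (#|block c i| = l /\ p i <= M) \/ l * p i <= #|block c i|) ->
    F \subset profile c p -> intersecting F ->
  l * #|F| <= M * #|profile c p|.
Proof.
move=> M0 Ml hp hF hI.
have /fin_all_exists[B hB] : forall t, exists B : 'I_l -> {set T},
    (forall i, B i \subset block c t /\ #|B i| = p t) /\ spread M B.
  by move=> t; apply: exists_windows; case: (hp t); [case|]; tauto.
pose A i := \bigcup_t B t i.
have AB t i : A i :&: block c t = B t i.
  have sub u : B u i \subset block c u by case: (hB u) => /(_ i)[].
  apply/setP => x; rewrite inE; apply/andP/idP => [[/bigcupP[u _ xu]]|xt].
    by move/subsetP: (sub u) => /(_ _ xu); rewrite !inE => /eqP-> /eqP<-.
  by split; [apply/bigcupP; exists t | move/subsetP: (sub t); apply].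
apply: (katona_averaging (A := A)) => // [i|s sG].
  by apply/profileP => t; rewrite AB; case: (hB t) => /(_ i)[].
apply: card_pairwise_close M0 Ml _ => i j; rewrite !inE => iF jF ij.
have /set0Pn[_ /setIP[/imsetP[x xi ->]]] := hI _ _ iF jF.
rewrite (mem_imset _ _ (@perm_inj _ s)) => xj.
case: (hB (c x)) => _; apply; first exact: ij.
by apply/set0Pn; exists x; rewrite -!AB !inE xi xj eqxx.
Qed.

(** * Counting sets by their traces *)

(** A set is determined by its traces on the blocks, and these can be chosen
independently. *)
Lemma card_profile (T I : finType) (c : T -> I) (p : I -> nat) :
  #|profile c p| = \prod_i 'C(#|block c i|, p i).
Proof.
pose cut (A : {set T}) := [ffun i => A :&: block c i].
have cut_inj : injective cut.
  move=> A B /ffunP AB; apply/setP => x; have /setP/(_ x) := AB (c x).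
  by rewrite !ffunE !inE eqxx !andbT.
pose Q i : pred {set T} := [pred B : {set T} | B \subset block c i & #|B| == p i].
rewrite -(card_imset _ cut_inj).
have -> : #|cut @: profile c p| = #|family Q|.
  apply: eq_card => f; apply/imsetP/familyP => [[A /profileP hA ->] i|hf].
    by rewrite ffunE inE /= subsetIr hA eqxx.
  pose A := \bigcup_i f i.
  have fA i : A :&: block c i = f i.
    have sub j : f j \subset block c j.
      by have := hf j; rewrite inE /= => /andP[].
    apply/setP => x; rewrite inE; apply/andP/idP => [[/bigcupP[j _ xj]]|xi].
      by move/subsetP: (sub j) => /(_ _ xj); rewrite !inE => /eqP-> /eqP<-.
    by split; [apply/bigcupP; exists i | move/subsetP: (sub i); apply].
  exists A; last by apply/ffunP => i; rewrite ffunE fA.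
  apply/profileP => i; rewrite fA.
  by have := hf i; rewrite inE /= => /andP[_ /eqP].
rewrite card_family foldrE big_image /=; apply: eq_bigr => i _.
by rewrite -cards_draws; apply: eq_card => B; rewrite !inE.
Qed.

Lemma card_ksubsets_containing (T : finType) (k : nat) (S : {set T}) :
    #|S| <= k <= #|T| ->
  #|[set A in ksubsets T k | S \subset A]| = 'C(#|T| - #|S|, k - #|S|).
Proof.
case/andP => Sk kT.
have -> : 'C(#|T| - #|S|, k - #|S|) = 'C(#|~: S|, #|T| - k).
  have := cardsC S; rewrite -(@bin_sub (#|T| - _)) ?leq_sub2r // => hS.
  by congr 'C(_, _); lia.
rewrite -cards_draws -[LHS](card_imset _ (@setC_inj T)); apply: eq_card => B.
apply/imsetP/idP => [[A]|].
  rewrite !inE => /andP[/eqP Ak SA] ->; rewrite setCS SA /=.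
  by apply/eqP; have := cardsC A; rewrite Ak => <-; rewrite addKn.
rewrite inE => /andP[BS /eqP cB]; exists (~: B); last by rewrite setCK.
by rewrite !inE -setCS setCK BS andbT; have := cardsC B; lia.
Qed.

(** Count the pairs of a [k]-set [A] and a triple of elements of [A], one from
each of [T1], [T2], [T3]; each triple lies in ['C(#|T| - 3, k - 3)] [k]-sets. *)
Lemma sum_trace_products (T : finType) (k : nat) (T1 T2 T3 : {set T}) :
    3 <= k <= #|T| ->
    [disjoint T1 & T2] -> [disjoint T1 & T3] -> [disjoint T2 & T3] ->
  \sum_(A in ksubsets T k) #|A :&: T1| * #|A :&: T2| * #|A :&: T3| =
  #|T1| * #|T2| * #|T3| * 'C(#|T| - 3, k - 3).
Proof.
move=> /andP[k3 kT] /disjoint_setI0 d12 /disjoint_setI0 d13 /disjoint_setI0 d23.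
have card_cap (A B : {set T}) : #|A :&: B| = \sum_(a in B) (a \in A).
  rewrite -sum1_card [RHS]big_mkcond [LHS]big_mkcond; apply: eq_bigr => x _.
  by rewrite inE; case: (x \in A); case: (x \in B).
transitivity (\sum_(a in T1) \sum_(b in T2) \sum_(d in T3)
    #|[set A in ksubsets T k | [set a; b; d] \subset A]|).
  under eq_bigr => A _ do rewrite (card_cap A T1) (card_cap A T2) (card_cap A T3).
  under eq_bigr => A _.
    rewrite -mulnA big_distrl /=.
    under eq_bigr => a _.
      rewrite big_distrl /= big_distrr /=.
      under eq_bigr => b _ do rewrite mulnA big_distrr /=.
      over.
    over.
  rewrite exchange_big; apply: eq_bigr => a _.
  rewrite exchange_big; apply: eq_bigr => b _.
  rewrite exchange_big; apply: eq_bigr => d _.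
  rewrite -sum1_card big_mkcond [RHS]big_mkcond; apply: eq_bigr => A _.
  rewrite !inE !subUset !sub1set.
  by case: (_ == _); case: (a \in A); case: (b \in A); case: (d \in A).
under eq_bigr => a a1.
  under eq_bigr => b b2.
    under eq_bigr => d d3.
      have c3 : #|[set a; b; d]| = 3.
        have ne (B C : {set T}) x y : B :&: C = set0 ->
            x \in B -> y \in C -> ((x != y) * (y != x)).
          move=> BC xB yC; rewrite (eq_sym y); suff -> : x != y by [].
          apply/eqP => xy.
          by have := in_set0 x; rewrite -BC inE xB xy yC.
        rewrite setUC cardsU1 cards2 !inE (negPf (ne _ _ _ _ d13 a1 d3).2).
        by rewrite (negPf (ne _ _ _ _ d23 b2 d3).2) (ne _ _ _ _ d12 a1 b2).1.
      rewrite card_ksubsets_containing c3 ?k3 //.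
      over.
    over.
  over.
rewrite !sum_nat_const; lia.
Qed.

Definition traces (T : finType) (k : nat) (T1 T2 T3 : {set T}) (x y z : nat) :=
  [set A in ksubsets T k |
    [&& #|A :&: T1| == x, #|A :&: T2| == y & #|A :&: T3| == z]].

Lemma sum_by_traces (T : finType) (k : nat) (T1 T2 T3 : {set T})
    (H : {set {set T}}) (g : nat -> nat -> nat -> nat) :
    H \subset ksubsets T k ->
  \sum_(A in H) g #|A :&: T1| #|A :&: T2| #|A :&: T3| =
  \sum_(x < k.+1) \sum_(y < k.+1) \sum_(z < k.+1)
    #|H :&: traces k T1 T2 T3 x y z| * g x y z.
Proof.
move=> /subsetP hH.
have small A B : A \in H -> #|A :&: B| < k.+1.
  by move/hH; rewrite inE ltnS => /eqP <-; apply/subset_leq_card/subsetIl.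
pose i (B A : {set T}) : 'I_k.+1 := inord #|A :&: B|.
rewrite (partition_big (i T1) xpredT) //=; apply: eq_bigr => x _.
rewrite (partition_big (i T2) xpredT) //=; apply: eq_bigr => y _.
rewrite (partition_big (i T3) xpredT) //=; apply: eq_bigr => z _.
have iE A B (u : 'I_k.+1) : A \in H -> (i B A == u) = (#|A :&: B| == u).
  by move=> AH; rewrite -val_eqE /= inordK ?small.
rewrite -sum_nat_const; apply: eq_big => [A|A].
  rewrite !inE; case: (boolP (A \in H)) => //= AH.
  by have := hH A AH; rewrite inE !iE // => -> /=; rewrite andbA.
by case/andP => /andP[/andP[AH]]; rewrite !iE // => /eqP-> /eqP-> /eqP->.
Qed.

(** The four values separate [T1], [T2], [T3] and the rest; indexing the blocks by
pairs of booleans makes case analysis and products over blocks compute. *)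
Definition side (T : finType) (T1 T2 T3 : {set T}) (x : T) : bool * bool :=
  ((x \in T1) || (x \in T2), (x \in T1) || (x \in T3)).

Definition sizes (x y z w : nat) (b : bool * bool) :=
  if b.1 then if b.2 then x else y else if b.2 then z else w.

Section Sides.
Variables (T : finType) (k : nat) (T1 T2 T3 : {set T}).
Hypotheses (d12 : [disjoint T1 & T2]) (d13 : [disjoint T1 & T3])
  (d23 : [disjoint T2 & T3]).

Lemma block_side b :
  block (side T1 T2 T3) b =
    if b.1 then if b.2 then T1 else T2
    else if b.2 then T3 else ~: (T1 :|: T2 :|: T3).
Proof.
apply/setP => x; move/pred0P: d12 => /(_ x); move/pred0P: d13 => /(_ x).
move/pred0P: d23 => /(_ x); rewrite !inE /side /=.
by case: b => [[] []] /=; rewrite ?inE; case: (x \in T1); case: (x \in T2);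
  case: (x \in T3).
Qed.

Lemma card_rest : #|~: (T1 :|: T2 :|: T3)| = #|T| - (#|T1| + #|T2| + #|T3|).
Proof.
have := cardsC (T1 :|: T2 :|: T3).
have -> : #|T1 :|: T2 :|: T3| = #|T1| + #|T2| + #|T3|.
  rewrite !cardsU setIUl (disjoint_setI0 d12) (disjoint_setI0 d13).
  by rewrite (disjoint_setI0 d23) setU0 cards0 !subn0.
by lia.
Qed.

Lemma card_split (A : {set T}) :
  #|A| = #|A :&: T1| + #|A :&: T2| + #|A :&: T3| + #|A :&: ~: (T1 :|: T2 :|: T3)|.
Proof.
rewrite -sum1_card (partition_big (side T1 T2 T3) xpredT) //=.
have E b :
    \sum_(x in A | side T1 T2 T3 x == b) 1 = #|A :&: block (side T1 T2 T3) b|.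
  by rewrite -sum1_card; apply: eq_bigl => x; rewrite !inE.
under eq_bigr => b _ do rewrite E block_side.
rewrite -(pair_bigA _ (fun b1 b2 => #|A :&: (if b1 then if b2 then T1 else T2
    else if b2 then T3 else ~: (T1 :|: T2 :|: T3))|)) /= !big_bool /=; lia.
Qed.

Lemma traces_eq0 x y z : k < x + y + z -> traces k T1 T2 T3 x y z = set0.
Proof.
move=> kxyz; apply/setP => A; rewrite !inE; apply/negP.
by case/andP => /eqP Ak /and3P[/eqP ? /eqP ? /eqP ?]; have := card_split A; lia.
Qed.

Lemma traces_profile x y z : x + y + z <= k ->
  traces k T1 T2 T3 x y z =
  profile (side T1 T2 T3) (sizes x y z (k - (x + y + z))).
Proof.
move=> kxyz; apply/setP => A; apply/idP/profileP => [|hA].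
  rewrite !inE => /andP[/eqP Ak /and3P[/eqP Ax /eqP Ay /eqP Az]] b.
  rewrite block_side; have := card_split A; case: b => [[] []] /=;
  by rewrite ?Ax ?Ay ?Az ?Ak /sizes //=; lia.
have := card_split A.
have := hA (true, true); have := hA (true, false).
have := hA (false, true); have := hA (false, false).
rewrite !block_side /sizes /= !inE => -> -> -> -> ->; rewrite !eqxx !andbT.
by apply/eqP; lia.
Qed.

Lemma card_traces x y z : x + y + z <= k ->
  #|traces k T1 T2 T3 x y z| =
  'C(#|T1|, x) * 'C(#|T2|, y) * 'C(#|T3|, z) *
    'C(#|T| - (#|T1| + #|T2| + #|T3|), k - (x + y + z)).
Proof.
move=> kxyz; rewrite traces_profile // card_profile.
under eq_bigr => b _ do rewrite block_side.
rewrite -(pair_bigA _ (fun b1 b2 => 'C(#|if b1 then if b2 then T1 else T2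
    else if b2 then T3 else ~: (T1 :|: T2 :|: T3)|, sizes x y z _ (b1, b2)))) /=.
by rewrite !big_bool /= /sizes /= card_rest !mulnA.
Qed.

End Sides.

(** * Balancing the types *)

(** The number of sets of type [(x, y, z)], for three disjoint [l]-sets in a ground set
with [n] further elements.  The guard is needed since [k - (x + y + z)] would
be truncated to [0]. *)
Definition trace_count (l n k x y z : nat) :=
  if x + y + z <= k then
    'C(l, x) * 'C(l, y) * 'C(l, z) * 'C(n, k - (x + y + z))
  else 0.

(** What the type [(x, 1, 1)] may use beyond its weight: all of its sets may be in
[F], for a cost [l] each, against a weight of [x]. *)
Definition excess (l n k x : nat) :=
  if l < 2 * x then (l - x) * trace_count l n k x 1 1 else 0.

Lemma trace_count_rot l n k x y z :
  trace_count l n k x y z = trace_count l n k y z x.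
Proof.
rewrite /trace_count (_ : y + z + x = x + y + z); last by lia.
by rewrite -(mulnA 'C(l, x)) (mulnC 'C(l, x)).
Qed.

(** Double counting of the moves of one element from the first set into the
second: from type [(x + 1, 1, 1)] there are [(x + 1) * (l - 1)] of them, and
[2 * (l - x)] lead to a given set of type [(x, 2, 1)]. *)
Lemma trace_count_shift l n k x :
  (x + 1) * (l - 1) * trace_count l n k (x + 1) 1 1 =
  2 * (l - x) * trace_count l n k x 2 1.
Proof.
rewrite /trace_count (_ : x + 1 + 1 + 1 = x + 2 + 1) //; last by lia.
case: ifP => _; last by rewrite !muln0.
have hx := mul_bin_left l x; have := mul_bin_left l 1; rewrite bin1 => h2.
rewrite !addn1; set w := 'C(n, _).
transitivity ((x.+1 * 'C(l, x.+1)) * ((l - 1) * l) * (l * w)); first by lia.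
by rewrite hx -h2; lia.
Qed.

(** The factor on the right is the weight [2 * x] minus what the bounds on [F] use
of it: [x] by the circle method when [2 * x <= l], and [l] otherwise. *)
Lemma excess_le_slack l n k x : 4 <= l ->
  excess l n k (x + 1) <=
  (if 2 * x <= l then x else 2 * x - l) * trace_count l n k x 2 1.
Proof.
move=> l4; rewrite /excess; case: ifP => // lx.
have pos : 0 < (x + 1) * (l - 1) by rewrite muln_gt0; lia.
rewrite -(leq_pmul2l pos) mulnCA trace_count_shift !mulnA leq_mul2r.
apply/orP; right; case: ifP => hx.
  rewrite (_ : (l - (x + 1)) * 2 * (l - x) = (l - (x + 1)) * (l - x) * 2);
    last by lia.
  rewrite (_ : (x + 1) * (l - 1) * x = x * (x + 1) * (l - 1)); last by lia.
  by rewrite !leq_mul //; lia.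
rewrite -[leqLHS]muln1.
rewrite (_ : (x + 1) * (l - 1) * _ = (l - 1) * (x + 1) * (2 * x - l));
  last by lia.
by rewrite !leq_mul //; lia.
Qed.

Lemma excess_small l n k x : 4 <= l -> x <= 2 -> excess l n k x = 0.
Proof. by rewrite /excess; case: ifP => //; lia. Qed.

(** For [x = 1] the circle method is applied with [M = 2], and nothing is received
because [2 * 2 <= l]. *)
Lemma balance_receiver l n k x f : 4 <= l -> 0 < x ->
    f <= trace_count l n k x 2 1 ->
    (forall M, x <= M -> 2 <= M -> 2 * M <= l ->
     l * f <= M * trace_count l n k x 2 1) ->
  l * f + excess l n k (x + 1) <= x * 2 * 1 * trace_count l n k x 2 1.
Proof.
move=> l4 x0 fN hM; have := excess_le_slack n k x l4.
set N := trace_count _ _ _ _ _ _ in fN hM *.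
have [x2|x1] := leqP 2 x; last first.
  rewrite excess_small //; last by lia.
  by have := hM 2; nia.
case: ifP => hx; first by have := hM x (leqnn x) x2 hx; lia.
have split2x : l * N + (2 * x - l) * N = 2 * x * N by rewrite -mulnDl subnKC; lia.
by have := leq_mul (leqnn l) fN; lia.
Qed.

(** If an entry [u] exceeds [l / 2], either the other two are [1] and the excess
makes up for the missing weight, or their product is at least [2] and the weight
exceeds [l]; otherwise the circle method applies and the largest entry is at
most the product. *)
Lemma balance_generic l n k x y z f : 4 <= l -> 0 < x -> 0 < y -> 0 < z ->
    f <= trace_count l n k x y z ->
    (forall M, x <= M -> y <= M -> z <= M -> 2 * M <= l ->
     l * f <= M * trace_count l n k x y z) ->
  l * f <= x * y * z * trace_count l n k x y z
        + ((y == 1) && (z == 1)) * excess l n k x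
        + ((z == 1) && (x == 1)) * excess l n k y
        + ((x == 1) && (y == 1)) * excess l n k z.
Proof.
move=> l4.
have heavy u v w g : 0 < u -> 0 < v -> 0 < w -> l < 2 * u ->
    g <= trace_count l n k u v w ->
  l * g <= u * v * w * trace_count l n k u v w
        + ((v == 1) && (w == 1)) * excess l n k u.
  move=> u0 v0 w0 lu gN; have := leq_mul (leqnn l) gN.
  case: (boolP ((v == 1) && (w == 1))) => [/andP[/eqP-> /eqP->]|nvw].
    rewrite /excess lu mul1n !muln1 -mulnDl => /leq_trans; apply.
    by rewrite leq_mul2r -leq_subLR leqnn orbT.
  rewrite mul0n addn0 => /leq_trans; apply; rewrite leq_mul2r; apply/orP; right.
  have : 2 <= v * w by move: nvw; nia.
  by rewrite -mulnA => vw; have := leq_mul (leqnn u) vw; lia.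
move=> x0 y0 z0 fN hM.
have [xl|xl] := ltnP l (2 * x).
  by have := heavy x y z f x0 y0 z0 xl fN; lia.
have [yl|yl] := ltnP l (2 * y).
  rewrite trace_count_rot in fN *.
  have := heavy y z x f y0 z0 x0 yl fN.
  by rewrite (_ : y * z * x = x * y * z); lia.
have [zl|zl] := ltnP l (2 * z).
  rewrite trace_count_rot trace_count_rot in fN *.
  have := heavy z x y f z0 x0 y0 zl fN.
  by rewrite (_ : z * x * y = x * y * z); lia.
rewrite -!addnA; apply: leq_trans (leq_addr _ _).
apply: leq_trans (hM (maxn x (maxn y z)) _ _ _ _) _; try lia.
rewrite leq_mul2r; apply/orP; right; rewrite !geq_max.
rewrite -{1}mulnA leq_pmulr ?leq_pmull ?muln_gt0 ?x0 ?y0 //= andbT.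
by rewrite mulnAC leq_pmull ?muln_gt0 ?x0.
Qed.

(** The types of the form [(x, 2, 1)] and their rotations receive the excess of
[(x + 1, 1, 1)] and its rotations.  The three forms exclude each other, so no
type receives twice; this is why the charge moves cyclically. *)
Lemma balance l n k x y z f : 4 <= l -> 0 < x -> 0 < y -> 0 < z ->
    f <= trace_count l n k x y z ->
    (forall M, x <= M -> y <= M -> z <= M -> 2 * M <= l ->
     l * f <= M * trace_count l n k x y z) ->
  l * f + ((y == 2) && (z == 1)) * excess l n k (x + 1)
        + ((z == 2) && (x == 1)) * excess l n k (y + 1)
        + ((x == 2) && (y == 1)) * excess l n k (z + 1) <=
  x * y * z * trace_count l n k x y z
        + ((y == 1) && (z == 1)) * excess l n k x
        + ((z == 1) && (x == 1)) * excess l n k y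
        + ((x == 1) && (y == 1)) * excess l n k z.
Proof.
move=> l4 x0 y0 z0 fN hM.
have receiver u g : 0 < u -> g <= trace_count l n k u 2 1 ->
    (forall M, u <= M -> 2 <= M -> 1 <= M -> 2 * M <= l ->
     l * g <= M * trace_count l n k u 2 1) ->
    l * g + excess l n k (u + 1) <= u * 2 * 1 * trace_count l n k u 2 1.
  move=> u0 gN gM; apply: balance_receiver => // M uM M2 Ml.
  by apply: gM => //; apply: ltnW.
case: (boolP ((y == 2) && (z == 1))) => [/andP[/eqP y2 /eqP z1]|nx].
  by move: fN hM; rewrite y2 z1 => fN hM; have := receiver x f x0 fN hM; lia.
case: (boolP ((z == 2) && (x == 1))) => [/andP[/eqP z2 /eqP x1]|ny].
  move: fN hM; rewrite z2 x1 trace_count_rot => fN hM.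
  have := receiver y f y0 fN (fun M a b c => hM M c a b); lia.
case: (boolP ((x == 2) && (y == 1))) => [/andP[/eqP x2 /eqP y1]|nz].
  move: fN hM; rewrite x2 y1 trace_count_rot trace_count_rot => fN hM.
  have := receiver z f z0 fN (fun M a b c => hM M b c a); lia.
by rewrite !mul0n !addn0; apply: balance_generic.
Qed.

Lemma sum_pinned K a b (e : nat -> nat) : a < K -> b < K ->
  \sum_(x < K) \sum_(y < K) \sum_(z < K)
    ((y == a :> nat) && (z == b :> nat)) * e x =
  \sum_(x < K) e x.
Proof.
move=> aK bK; apply: eq_bigr => x _.
rewrite (bigD1 (Ordinal aK)) //= (bigD1 (Ordinal bK)) //= !eqxx mul1n.
rewrite !big1 ?addn0 // => [y|z].
  rewrite -val_eqE /= => /negPf ya; rewrite big1 // => z _.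
  by rewrite ya.
by rewrite -val_eqE /= => /negPf->.
Qed.

Lemma sum_rot K (g : 'I_K -> 'I_K -> 'I_K -> nat) :
  \sum_(x < K) \sum_(y < K) \sum_(z < K) g x y z =
  \sum_(x < K) \sum_(y < K) \sum_(z < K) g z x y.
Proof.
rewrite exchange_big; apply: eq_bigr => y _.
by rewrite exchange_big.
Qed.

Lemma leq_sum_shift K (e : nat -> nat) : e 0 = 0 ->
  \sum_(x < K) e x <= \sum_(x < K) e (x + 1).
Proof.
move=> e0; apply: leq_trans (_ : \sum_(x < K.+1) e x <= _).
  by rewrite big_ord_recr leq_addr.
by rewrite big_ord_recl e0; apply: leq_sum => x _; rewrite /bump /= addnC.
Qed.

(** After summation, each kind of charge is received as [e (x + 1)] and emitted as
[e x], over the same range of [x]; the shifted sum is at least the other one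
because [e 0 = 0]. *)
Lemma total_balance (l n k : nat) (f : nat -> nat -> nat -> nat) :
    4 <= l -> 3 <= k ->
    (forall x y z, ~~ [&& 0 < x, 0 < y & 0 < z] -> f x y z = 0) ->
    (forall x y z, f x y z <= trace_count l n k x y z) ->
    (forall x y z M, 0 < x -> 0 < y -> 0 < z ->
     x <= M -> y <= M -> z <= M -> 2 * M <= l ->
     l * f x y z <= M * trace_count l n k x y z) ->
  l * (\sum_(x < k.+1) \sum_(y < k.+1) \sum_(z < k.+1) f x y z) <=
  \sum_(x < k.+1) \sum_(y < k.+1) \sum_(z < k.+1)
    x * y * z * trace_count l n k x y z.
Proof.
move=> l4 k3 f0 fN fM.
set e := excess l n k.
have local x y z :
    l * f x y z + ((y == 2) && (z == 1)) * e (x + 1)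
        + ((z == 2) && (x == 1)) * e (y + 1)
        + ((x == 2) && (y == 1)) * e (z + 1) <=
  x * y * z * trace_count l n k x y z
        + ((y == 1) && (z == 1)) * e x
        + ((z == 1) && (x == 1)) * e y
        + ((x == 1) && (y == 1)) * e z.
  case: (boolP [&& 0 < x, 0 < y & 0 < z]) => [/and3P[x0 y0 z0]|nxyz].
    by apply: balance => // M; apply: fM.
  (* Such a type could only receive the excess at 1, which is zero. *)
  rewrite f0 // muln0 add0n.
  have e1 : e (0 + 1) = 0 by rewrite /e excess_small.
  by move: nxyz; rewrite !lt0n !negb_and !negbK => /or3P[] /eqP->;
    rewrite e1 ?andbF ?muln0.
pose S (g : nat -> nat -> nat -> nat) :=
  \sum_(x < k.+1) \sum_(y < k.+1) \sum_(z < k.+1) g x y z.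
have SD g h : S (fun x y z => g x y z + h x y z) = S g + S h.
  rewrite /S -big_split; apply: eq_bigr => x _.
  by rewrite -big_split; apply: eq_bigr => y _; rewrite -big_split.
have Sle g h : (forall x y z, g x y z <= h x y z) -> S g <= S h.
  by move=> gh; do 3![apply: leq_sum => ? _].
have pin a b (h : nat -> nat) : a <= k -> b <= k ->
    [/\ S (fun x y z => ((y == a) && (z == b)) * h x) = \sum_(x < k.+1) h x,
        S (fun x y z => ((z == a) && (x == b)) * h y) = \sum_(x < k.+1) h x &
        S (fun x y z => ((x == a) && (y == b)) * h z) = \sum_(x < k.+1) h x].
  move=> ak bk; rewrite /S; split; first exact: sum_pinned.
  by rewrite sum_rot; apply: sum_pinned.
  by rewrite sum_rot sum_rot; apply: sum_pinned.
have := Sle _ _ local; rewrite !SD.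
have [-> -> ->] := pin 2 1 (fun x => e (x + 1)) (ltnW k3) (ltnW (ltnW k3)).
have [-> -> ->] := pin 1 1 e (ltnW (ltnW k3)) (ltnW (ltnW k3)).
have -> : S (fun x y z => l * f x y z) = l * S f.
  rewrite /S !big_distrr /=; apply: eq_bigr => x _.
  by rewrite big_distrr; apply: eq_bigr => y _; rewrite big_distrr.
have := @leq_sum_shift k.+1 e (excess_small n k l4 (leq0n 2)).
rewrite -/(S f) -/(S (fun x y z => x * y * z * trace_count l n k x y z)).
by move: (S f) (S _) (\sum_(_ < _) _) (\sum_(_ < _) _) => a b c d; lia.
Qed.

Theorem theorem3 (k l m : nat) (hk : 3 <= k) (hl : 4 <= l) (hm : k * l <= m)
    (T1 T2 T3 : {set 'I_m})
    (hT1 : #|T1| = l) (hT2 : #|T2| = l) (hT3 : #|T3| = l)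
    (h12 : [disjoint T1 & T2]) (h13 : [disjoint T1 & T3])
    (h23 : [disjoint T2 & T3])
    (F : {set {set 'I_m}}) (hF : F \subset ksubsets 'I_m k)
    (hI : intersecting F)
    (hT : forall A : {set 'I_m}, A \in F ->
       [/\ A :&: T1 != set0, A :&: T2 != set0 & A :&: T3 != set0]) :
  #|F| <= l ^ 2 * 'C(m - 3, k - 3).
Proof.
have l0 : 0 < l by lia.
have km : k <= m by apply: leq_trans hm; rewrite leq_pmulr.
pose n := m - (l + l + l).
pose f x y z := #|F :&: traces k T1 T2 T3 x y z|.
have traceE x y z : #|traces k T1 T2 T3 x y z| = trace_count l n k x y z.
  rewrite /trace_count; case: leqP => [xyz|xyz].
    by rewrite card_traces // hT1 hT2 hT3 card_ord.
  by rewrite traces_eq0 // cards0.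
have fN x y z : f x y z <= trace_count l n k x y z.
  by rewrite -traceE subset_leq_card ?subsetIr.
have f0 x y z : ~~ [&& 0 < x, 0 < y & 0 < z] -> f x y z = 0.
  apply: contraNeq; rewrite -lt0n => /card_gt0P[A]; rewrite !inE.
  case/andP => /hT[? ? ?] /andP[_ /and3P[/eqP<- /eqP<- /eqP<-]].
  by rewrite !card_gt0; apply/and3P.
have fM x y z M : 0 < x -> 0 < y -> 0 < z -> x <= M -> y <= M -> z <= M ->
    2 * M <= l -> l * f x y z <= M * trace_count l n k x y z.
  move=> x0 y0 z0 xM yM zM Ml; have [xyz|xyz] := leqP (x + y + z) k; last first.
    by rewrite /f traces_eq0 // setI0 cards0 muln0.
  rewrite -traceE /f traces_profile //.
  apply: katona_blocks => // [|b||A B].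
  - exact: leq_trans xM.
  - rewrite block_side // /sizes; case: b => [[] []] /=; [by left..|right].
    (* The rest has room for l disjoint sets: l * (k - 3) <= m - 3 * l. *)
    rewrite card_rest // hT1 hT2 hT3 card_ord.
    have : (k - (x + y + z)) * l <= (k - 3) * l by rewrite leq_mul2r; lia.
    by rewrite mulnBl; lia.
  - exact: subsetIr.
  - by rewrite !inE => /andP[AF _] /andP[BF _]; apply: hI.
rewrite -(leq_pmul2l l0).
have total_F : #|F| = \sum_(x < k.+1) \sum_(y < k.+1) \sum_(z < k.+1) f x y z.
  rewrite -sum1_card (sum_by_traces T1 T2 T3 (fun _ _ _ => 1) hF).
  by do 3![apply: eq_bigr => ? _]; rewrite muln1.
rewrite total_F; apply: leq_trans (total_balance hl hk f0 fN fM) _.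
have := @sum_trace_products _ k _ _ _ _ h12 h13 h23.
rewrite card_ord hk km hT1 hT2 hT3 => /(_ isT) trace_sum.
rewrite (_ : l * (l ^ 2 * _) = l * l * l * 'C(m - 3, k - 3)); last by lia.
rewrite -trace_sum (sum_by_traces _ _ _ (fun x y z => x * y * z) (subxx _)).
apply: eq_leq; do 3![apply: eq_bigr => ? _]; rewrite -traceE mulnC.
congr (_ * _); congr #|pred_of_set _|; apply/esym/setIidPr/subsetP => A.
by rewrite inE => /andP[].
Qed.
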